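(* Let $1 \leq p < \infty$ and let $X$ be a Banach space. Then $X$ has the coarse $p$-DP* property if and only if every bounded linear operator $T: X \to \ell_p$ is completely continuous.
   Context: A subset $A$ of a Banach space $X$ is coarse $p$-limited if $T(A)$ is a relatively compact subset of $\ell_p$ for every bounded linear operator $T: X \to \ell_p$. A Banach space $X$ has the coarse $p$-DP* property if every relatively weakly compact subset of $X$ is coarse $p$-limited. A bounded linear operator is completely continuous if it maps weakly convergent sequences to norm convergent sequences. *)

(* Defs.v *)
From HB Require Import structures.
From mathcomp Require Import all_boot all_order all_algebra.
From mathcomp Require Import all_classical all_reals all_analysis.
From mathcomp Require Import complex.

Set Implicit Arguments.
Unset Strict Implicit.
Unset Printing Implicit Defensive.

Import Order.TTheory GRing.Theory Num.Theory.
Import numFieldNormedType.Exports.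

Local Open Scope classical_set_scope.
Local Open Scope ring_scope.

(* The norm of a numFieldType K is K-valued, while the p-th powers and sums
   defining the l_p norm live in R; [scalars R K] provides the passage between
   the two. Only the instances K = R and K = R[i] below are used. *)
Record scalars (R : realType) (K : numFieldType) := Scalars {
  absr : K -> R;
  emb : {rmorphism R -> K};
  emb_mono : {mono emb : x y / x <= y};
  absrE : forall z : K, `|z| = emb (absr z) }.

Definition real_scalars (R : realType) : scalars R R :=
  @Scalars R R (fun z => `|z|) idfun (fun _ _ => erefl) (fun _ => erefl).

Definition complex_scalars (R : realType) : scalars R R[i] :=
  @Scalars R R[i] (@ComplexField.Normc.normc R) (real_complex R)
    (@lecR R) (fun _ => erefl).

Section lp_space.
Variables (R : realType) (K : numFieldType) (s : scalars R K).
Variables (p : R) (p1 : 1 <= p).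

(* (\sum_k |f k|^p)^(1/p), see Lnorm_counting *)
Definition lp_enorm (f : nat -> K^o) : \bar R :=
  ('N[counting]_(p%:E)[EFin \o (absr s \o f)])%E.

(* The proof argument is what the vector-space and norm instances on the
   subtype [lp] below are indexed by. *)
Definition lp_fin of 1 <= p : {pred nat -> K^o} :=
  fun f => (lp_enorm f < +oo)%E.

Let emb_inj : injective (emb s).
Proof. exact: fmorph_inj. Qed.

Let absr_ge0 z : 0 <= absr s z.
Proof. by rewrite -(emb_mono s) rmorph0 -absrE. Qed.

Let absrD x y : absr s (x + y) <= absr s x + absr s y.
Proof. by rewrite -(emb_mono s) rmorphD -!absrE ler_normD. Qed.

Let absrM x y : absr s (x * y) = absr s x * absr s y.
Proof. by apply: emb_inj; rewrite rmorphM -!absrE normrM. Qed.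

Let absr0 : absr s 0 = 0.
Proof. by apply: emb_inj; rewrite rmorph0 -absrE normr0. Qed.

Let absr0_eq0 z : absr s z = 0 -> z = 0.
Proof. by move=> z0; apply/eqP; rewrite -normr_eq0 (absrE s) z0 rmorph0. Qed.

Let p0 : 0 < p.
Proof. exact: lt_le_trans ltr01 p1. Qed.

Let enorm_ge0 f : (0 <= lp_enorm f)%E.
Proof. exact: Lnorm_ge0. Qed.


Let enormE f : lp_enorm f =
  poweR (\sum_(0 <= k <oo) ((absr s (f k)) `^ p)%:E)%E p^-1.
Proof.
rewrite /lp_enorm Lnorm_counting//; congr (poweR _ _).
by apply: eq_eseriesr => k _ /=; rewrite ger0_norm.
Qed.

Let sum_ge0 f : (0 <= \sum_(0 <= k <oo) ((absr s (f k)) `^ p)%:E :> \bar R)%E.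
Proof. by apply: nneseries_ge0 => k _ _; rewrite lee_fin powR_ge0. Qed.

Let le_enorm f g : (forall k, absr s (f k) <= absr s (g k)) ->
  (lp_enorm f <= lp_enorm g)%E.
Proof.
move=> fg; rewrite !enormE; apply: gt0_ler_poweR.
- by rewrite invr_ge0 ltW.
- by rewrite in_itv/= sum_ge0 leey.
- by rewrite in_itv/= sum_ge0 leey.
apply: lee_nneseries => k *; rewrite lee_fin ?powR_ge0//.
by rewrite ge0_ler_powR// ?nnegrE// ltW.
Qed.

Let absr_emb x : 0 <= x -> absr s (emb s x) = x.
Proof.
move=> x0; apply: emb_inj.
by rewrite -absrE ger0_norm// -(rmorph0 (emb s)) emb_mono.
Qed.

Let enormD (f g : nat -> K^o) :
  (lp_enorm (f + g)%R <= lp_enorm f + lp_enorm g)%E.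
Proof.
pose h k : K := emb s (absr s (f k) + absr s (g k)).
have hE k : absr s (h k) = absr s (f k) + absr s (g k).
  by rewrite absr_emb// addr_ge0.
apply: (@le_trans _ _ (lp_enorm h)).
  by apply: le_enorm => k; rewrite hE; exact: absrD.
rewrite {1}/lp_enorm.
have -> : absr s \o h = ((absr s \o f) \+ (absr s \o g)).
  by apply/funext => k /=; rewrite hE.
exact: eminkowski.
Qed.

Let enormZ (a : K) (f : nat -> K^o) :
  (lp_enorm (a *: f)%R = (absr s a)%:E * lp_enorm f)%E.
Proof.
rewrite !enormE.
under eq_eseriesr => k _ do rewrite [absr s _]absrM powRM// EFinM.
rewrite nneseriesZl; last by move=> k _; rewrite lee_fin powR_ge0.
rewrite poweRM ?lee_fin ?powR_ge0// poweR_EFin -powRrM mulfV ?gt_eqF//.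
by rewrite powRr1.
Qed.

Let enorm_eq0 f : lp_enorm f = 0%E -> f = 0.
Proof.
rewrite enormE => /(poweR_eq0_eq0 (sum_ge0 f)) f0; apply/funext => k.
apply: absr0_eq0; apply/eqP.
have : (((absr s (f k)) `^ p)%:E <= 0 :> \bar R)%E.
  rewrite -f0; apply: le_trans (nneseries_lim_ge k.+1 _); last first.
    by move=> n _ _; rewrite lee_fin powR_ge0.
  rewrite big_nat_recr//= leeDr// sume_ge0// => i _.
  by rewrite lee_fin powR_ge0.
rewrite lee_fin => fk0.
have : (absr s (f k)) `^ p == 0 by rewrite eq_le fk0 powR_ge0.
by rewrite powR_eq0 => /andP[].
Qed.

Lemma lp_fin_submod_closed : submod_closed (lp_fin p1).
Proof.
split=> [|a f g ff gf].
  rewrite unfold_in enormE.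
  rewrite eseries0 ?poweR0r ?invr_eq0 ?gt_eqF ?ltry// => k _ _.
  by rewrite absr0 powR0// gt_eqF.
rewrite unfold_in; apply: (le_lt_trans (enormD _ _)).
by rewrite lte_add_pinfty// enormZ lte_mul_pinfty// lee_fin.
Qed.

HB.instance Definition _ :=
  GRing.isSubmodClosed.Build _ _ (lp_fin p1) lp_fin_submod_closed.

Record lp := Lp { lp_val :> nat -> K^o ; lp_valP : lp_val \in lp_fin p1 }.

HB.instance Definition _ := [isSub for lp_val].
HB.instance Definition _ := [Choice of lp by <:].
HB.instance Definition _ := [SubChoice_isSubLmodule of lp by <:].

Definition lp_norm (f : lp) : K := emb s (fine (lp_enorm f)).

Let enorm_fin (f : lp) : (fine (lp_enorm f))%:E = lp_enorm f.
Proof. by rewrite fineK// ge0_fin_numE//; exact: lp_valP. Qed.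

Let lp_normD (f g : lp) : lp_norm (f + g) <= lp_norm f + lp_norm g.
Proof.
rewrite /lp_norm -rmorphD emb_mono -lee_fin EFinD !enorm_fin.
exact: enormD.
Qed.

Let lp_normZ (a : K) (f : lp) : lp_norm (a *: f) = `|a| * lp_norm f.
Proof.
rewrite /lp_norm (absrE s) -rmorphM; congr (emb s _).
by apply: EFin_inj; rewrite EFinM !enorm_fin; exact: enormZ.
Qed.

Let lp_norm0_eq0 (f : lp) : lp_norm f = 0 -> f = 0.
Proof.
rewrite /lp_norm -(rmorph0 (emb s)) => /emb_inj f0.
by apply/val_inj/enorm_eq0; rewrite -enorm_fin f0.
Qed.

HB.instance Definition _ :=
  Lmodule_isNormed.Build K lp lp_normD lp_normZ lp_norm0_eq0.

End lp_space.

Section operators.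
Variables (K : numFieldType) (X Y : normedModType K).

Definition bounded_operator (T : X -> Y) :=
  exists M : K, forall x, `|T x| <= M * `|x|.

End operators.

Section weak_topology.
Variables (K : numFieldType) (X : normedModType K).

Definition dual := {f : {linear X -> K^o} | bounded_operator f}.

Definition weak := sup_topology (fun f : dual =>
  Topological.class (initial_topology (sval f : X -> K^o))).

HB.instance Definition _ := Topological.on weak.

Definition relatively_weakly_compact (A : set X) := precompact (A : set weak).

Definition weakly_convergent (u : nat -> X) := cvg ((u : nat -> weak) @ \oo).

End weak_topology.

Definition completely_continuous (K : numFieldType) (X Y : normedModType K)
    (T : X -> Y) :=
  forall u : nat -> X, weakly_convergent u -> cvg (T \o u @ \oo).

Section coarse.
Variables (R : realType) (K : numFieldType) (s : scalars R K).
Variables (p : R) (p1 : 1 <= p) (X : normedModType K).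

Definition coarse_p_limited (A : set X) :=
  forall T : {linear X -> lp s p1}, bounded_operator T -> precompact (T @` A).

Definition coarse_p_DPstar :=
  forall A : set X, relatively_weakly_compact A -> coarse_p_limited A.

End coarse.

(* Main.v *)
Require Import Defs.
From HB Require Import structures.
From mathcomp Require Import all_boot all_order all_algebra.
From mathcomp Require Import all_classical all_reals all_analysis.
From mathcomp Require Import complex.

(** Suppose that X has the coarse p-DP* property, that T : X -> l_p is bounded
and that u converges weakly to x.  The range of u is relatively weakly compact,
so T maps it into a norm-compact set.  The coordinates of T are bounded
functionals, so T u_n converges to T x in every coordinate, and T x is the only
possible norm cluster point of T u_n ([weak_cvg_image_cluster]).  A sequence in
a compact set with a single cluster point converges to it.

For the converse let B be the weak closure of a relatively weakly compact set.
Every sequence in B has a weakly convergent subsequence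
([weakly_compact_subseq]); if T is completely continuous, every sequence in
T(B) then has a cluster point in T(B), and T(B) is compact because l_p is
metrizable ([seq_cluster_compact]).

The extraction of a weakly convergent subsequence is the easy half of the
Eberlein-Smulian theorem.  Its usual proof picks a countable total set of
functionals with the Hahn-Banach theorem.  Here the compactness of the dual
ball for pointwise convergence (Banach-Alaoglu) is used in its place.  Given a
sequence b in B with weak cluster point x, for each N finitely many functionals
of the dual ball approximate all others on b_0, ..., b_(N-1) up to 1/(N+1).
Choose a subsequence along which each of these countably many functionals d
converges to d x.  Let y be another cluster point of the subsequence and f a
functional of the dual ball.  Take d_N among the chosen functionals with d_N
close to f on b_0, ..., b_(N-1), and a pointwise cluster point g of (d_N).
Then g = f on every b_n, hence also at the cluster points x and y of b, whereas
g x = g y because d_N x = d_N y for all N.  So f x = f y: all cluster points of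
the subsequence are weakly indistinguishable, and by compactness of B the
subsequence converges weakly to x.

Weakly indistinguishable points are never told apart by the argument, which
uses the regularity of the weak topology instead of its separation: in a regular
space the subsets of a compact set have compact closures
([regular_precompact]).  Both scalar fields are treated at once, through two
properties: closed balls are compact, and 1/(n+1) tends to 0. *)

Set Implicit Arguments.
Unset Strict Implicit.
Unset Printing Implicit Defensive.

Import Order.TTheory GRing.Theory Num.Theory.
Import numFieldNormedType.Exports.

Local Open Scope classical_set_scope.
Local Open Scope ring_scope.

(** * Cluster points, compactness and regularity *)

(** A limit along F is inherited at the cluster points of F.  This is how
equalities valid along a sequence are carried over to its cluster points. *)
Lemma cluster_cvg_eq (T U : topologicalType) (F : set_system T) (x : T)
    (g : T -> U) (c : U) : Filter F -> hausdorff_space U ->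
  {for x, continuous g} -> cluster F x -> g @ F --> c -> g x = c.
Proof.
move=> FF hU gx Fx gc; apply: hU => A B gA cB.
by have [z [Bz Az]] := Fx _ _ (gc _ cB) (gx _ gA); exists (g z).
Qed.

(** If g did not converge to c, some neighborhood V of c would have a preimage
outside F; restricting F to the complement of this preimage would give, by
compactness, a cluster point z of F with g z != c.  Having g, instead of the
identity, allows for spaces where distinct points are not separated. *)
Lemma compact_unique_cluster_cvg (T U : topologicalType) (C : set T)
    (F : set_system T) (g : T -> U) (c : U) :
  ProperFilter F -> compact C -> F C ->
  continuous g -> (forall z, C z -> cluster F z -> g z = c) -> g @ F --> c.
Proof.
move=> FF cC FC gc gE A /= cA; apply: contrapT => nFA.
have nA : ~ F (g @^-1` A) by [].
pose G := within (~` (g @^-1` A)) F.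
have GG : ProperFilter G.
  apply: Build_ProperFilter_ex => B GB; apply: contrapT => nB; apply: nA.
  have : F [set t | ~ A (g t) -> B t] := GB.
  apply: filterS => t /= tB; apply: contrapT => nAt; apply: nB.
  by exists t; apply: tB.
have [z [Cz Gz]] : C `&` cluster G !=set0.
  by apply: cC; apply: filterS FC => t Ct _.
have gz : g z = c.
  apply: gE => // P Q FP; apply: Gz.
  by apply: filterS FP => t.
have zA : nbhs z (g @^-1` A) by apply: gc; rewrite gz.
have GA : G (~` (g @^-1` A)).
  by rewrite /G /within /=; apply: nearW.
by have [t [nt yt]] := Gz _ _ GA zA; exact: nt.
Qed.

Lemma initial_regular (S : choiceType) (T : topologicalType) (f : S -> T) :
  regular_space T -> regular_space (initial_topology f).
Proof.
move=> rT a A aA.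
have [_ [[V oV <-] /= Vfa] VA] :
  exists2 B, open_nbhs (a : initial_topology f) B & B `<=` A.
  by move: aA; rewrite nbhsE.
have [N fN NV] := rT (f a) V (open_nbhs_nbhs (conj oV Vfa)).
exists (f @^-1` N); first exact: (@initial_continuous S T f a _ fN).
move=> y yN; apply/VA/NV => B yB.
have [z [Nz Bz]] := yN _ (@initial_continuous S T f y B yB).
by exists (f z).
Qed.

Lemma sup_regular (T : choiceType) (I : Type) (Tc : I -> Topological T) :
  (forall i, regular_space (Topological.Pack (Tc i))) ->
  regular_space (sup_topology Tc).
Proof.
move=> rT a.
have sub i (x : T) : nbhs (x : sup_topology Tc) `=>`
    nbhs (x : Topological.Pack (Tc i)).
  by have /cvg_sup : nbhs (x : sup_topology Tc) --> (x : sup_topology Tc) by [].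
have FF : Filter (filter_from (nbhs (a : sup_topology Tc)) closure).
  apply: filter_from_filter; first by exists setT; exact: filterT.
  move=> A B aA aB; exists (A `&` B); first exact: filterI.
  by move=> x; apply: closureI.
apply/cvg_sup => i A /= aA.
have [N aN NA] := rT i a A aA.
exists N; first exact: sub aN.
move=> y yN; apply: NA => B yB; apply: yN; exact: sub yB.
Qed.

(** In a space that is not separated the compact set C need not be closed.  A
filter F on the closure of C is replaced by the traces on C of the open members
of F; a cluster point of these traces in C is a cluster point of F because its
closed neighborhoods have open complements. *)
Lemma regular_precompact (T : topologicalType) (A C : set T) :
  regular_space T -> compact C -> A `<=` C -> precompact A.
Proof.
move=> rT cC sAC; apply: (precompact_subset sAC); rewrite precompactE.
move=> F FF FC.
pose G := filter_from [set W : set T | open W /\ F W]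
  (fun W => (W `&` C)%classic).
have GG : ProperFilter G.
  apply: filter_from_proper.
    apply: filter_from_filter.
      by exists setT; split; [exact: openT|exact: filterT].
    move=> V W [oV FV] [oW FW]; exists (V `&` W); last by move=> x [[? ?] ?].
    by split; [exact: openI|exact: filterI].
  move=> W [oW FW]; have [x [clx Wx]] := filter_ex (filterI FC FW).
  have [z [Cz Wz]] := clx _ (open_nbhs_nbhs (conj oW Wx)).
  by exists z.
have [a [Ca Ga]] : C `&` cluster G !=set0.
  by apply: cC; exists setT; [split; [exact: openT|exact: filterT]|move=> x []].
exists a; split; first exact: subset_closure.
move=> E N FE aN; apply: contrapT => EN.
have [M aM MN] := rT a N aN.
have [x [[xM _] Mx]] : (~` closure M) `&` C `&` M !=set0.
  apply: Ga => //; exists (~` closure M) => //; split.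
    by apply: closed_openC; exact: closed_closure.
  apply: filterS FE => x Ex xM; apply: EN; exists x; split => //; exact: MN.
by apply: xM; apply: subset_closure.
Qed.

(** * Sequences and compactness *)

(** Each term may depend on the list of all the previous ones. *)
Lemma recursive_choice (T : Type) (P : seq T -> T -> Prop) :
  (forall s, exists x, P s x) ->
  exists u : nat -> T, forall n, P (mkseq u n) (u n).
Proof.
move=> /choice[g gP].
pose pre := fix pre n := if n is m.+1 then rcons (pre m) (g (pre m)) else [::].
exists (g \o pre) => n /=.
suff -> : mkseq (g \o pre) n = pre n by exact: gP.
by elim: n => // n IH; rewrite mkseqS IH.
Qed.

Lemma range_eventually (T : Type) (u : nat -> T) (B : set T) :
  (forall n, B (u n)) -> (u @ \oo) B.
Proof. by move=> uB; exists 0%N => // n _; exact: uB. Qed.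

Lemma cluster_seqE (T : topologicalType) (u : nat -> T) (y : T) :
  cluster (u @ \oo) y <->
  forall W, nbhs y W -> forall n, exists2 m, (n <= m)%N & W (u m).
Proof.
split=> [uy W yW n|uy A B [N _ NA] yB].
  have [|_ [[m nm <-] Wm]] := uy [set u m | m in [set m | (n <= m)%N]] W _ yW.
    by exists n => // m nm; exists m.
  by exists m.
by have [m Nm Bm] := uy _ yB N; exists (u m); split => //; exact: NA.
Qed.

(** Were there no finite net, points far from all the previous ones could be
chosen forever.  The abstract relation [close] serves both for balls of a metric
space and for functionals compared at finitely many points. *)
Lemma finite_net (T : choiceType) (D : set T) (close : T -> T -> Prop) :
  (forall u : nat -> T, (forall n, D (u n)) ->
    exists i j, (i < j)%N /\ close (u i) (u j)) ->
  exists2 s : seq T, {in s, forall x, D x} &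
    forall y, D y -> exists2 x, x \in s & close x y.
Proof.
move=> sepF; apply: contrapT => noNet.
have far (s : seq T) : {in s, forall x, D x} ->
    exists y, D y /\ {in s, forall x, ~ close x y}.
  move=> sD; apply: contrapT => nofar; apply: noNet; exists s => // y Dy.
  apply: contrapT => nxy; apply: nofar; exists y; split => // x xs xy.
  by apply: nxy; exists x.
have [x0 _] : exists y, D y /\ {in ([::] : seq T), forall x, ~ close x y}.
  exact: far.
have [|u uP] := @recursive_choice T (fun (s : seq T) y =>
    {in s, forall x, D x} -> D y /\ {in s, forall x, ~ close x y}).
  move=> s; have [/far[y ?]|nsD] := pselect {in s, forall x, D x}.
    by exists y.
  by exists x0.
have uD n : D (u n).
  elim/ltn_ind: n => n IH; apply: (uP n _).1 => _ /mapP[i + ->].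
  by rewrite mem_iota => /IH.
have [i [j [ij]]] := sepF u uD.
apply: (uP j _).2; first by move=> _ /mapP[k _ ->].
by apply/mapP; exists i => //; rewrite mem_iota.
Qed.

(** Sequential compactness implies compactness in a pseudometric space: C is
totally bounded, so an ultrafilter F on C contains a ball B(y_n, 1/(n+1)) for
each n.  A cluster point of a sequence whose n-th term lies in the first n+1 of
these balls is then a limit of F. *)
Lemma seq_cluster_compact (K : numFieldType) (Y : pseudoMetricType K)
    (C : set Y) : (forall e : K, 0 < e -> exists n, n.+1%:R^-1 < e) ->
  (forall u : nat -> Y, (forall n, C (u n)) ->
    exists2 y, C y & cluster (u @ \oo) y) -> compact C.
Proof.
move=> arch seqC; rewrite compact_ultra => F FU FC.
have small (e : K) : 0 < e -> exists y, F (ball y e).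
  move=> e0.
  have [u uC|s _ sP] := @finite_net Y C (fun x y => ball x e y).
    have [y _ /cluster_seqE uy] := seqC u uC.
    have yW : nbhs y (ball y (e / 2)) by apply: nbhsx_ballx; rewrite divr_gt0.
    have [i _ yi] := uy _ yW 0%N.
    have [j ij yj] := uy _ yW i.+1.
    by exists i, j; split => //; apply: ball_splitr yi yj.
  apply: contrapT => noball.
  have nF x : F (~` ball x e).
    by have [Fx|//] := in_ultra_setVsetC (ball x e) FU; case: noball; exists x.
  have : F [set y | {in s, forall x, ~ ball x e y}].
    elim: s {sP} => [|x s IH]; first exact: (filterS _ filterT).
    apply: filterS (filterI IH (nF x)) => y [ys xy] z.
    by rewrite inE => /orP[/eqP ->|/ys].
  move=> /(filterI FC)/filter_ex [y [Cy ys]].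
  by have [x xs] := sP y Cy; exact: ys.
have /choice [y yF] : forall n, exists y, F (ball y n.+1%:R^-1).
  by move=> n; apply: small; rewrite invr_gt0 ltr0Sn.
have FE n : F [set x | C x /\ forall i, (i <= n)%N -> ball (y i) i.+1%:R^-1 x].
  elim: n => [|n IH].
    by apply: filterS (filterI FC (yF 0%N)) => x [Cx yx]; split => // -[].
  apply: filterS (filterI IH (yF n.+1)) => x [[Cx yx] ynx]; split => // i.
  by rewrite leq_eqVlt => /orP[/eqP ->|/yx].
have [u uE] := choice (fun n => filter_ex (FE n)).
have [x Cx /cluster_seqE ux] := seqC u (fun n => (uE n).1).
exists x; split => // A /nbhs_ballP[e /= e0 eA].
have e2 : 0 < e / 2 by rewrite divr_gt0.
have e4 : 0 < e / 2 / 2 by rewrite divr_gt0.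
have [n ne] := arch _ e4.
have [m nm xm] := ux _ (nbhsx_ballx x _ e2) n.
apply: filterS (yF n) => z yz; apply: eA.
apply: (ball_split xm); apply: (@ball_splitr _ _ (y n)).
  by apply: le_ball (ltW ne) _ _; exact: (uE m).2.
by apply: le_ball (ltW ne) _ yz.
Qed.

(** An ultrafilter on the range that does not converge to x avoids a
neighborhood of x, hence lives on finitely many terms. *)
Lemma cvg_range_compact (T : topologicalType) (u : nat -> T) (x : T) :
  u @ \oo --> x -> compact (range u `|` [set x]).
Proof.
move=> ux; rewrite compact_ultra => F FU FS.
have [Fx|nFx] := pselect (F --> x); first by exists x; split => //; right.
have [A xA nFA] : exists2 A, nbhs x A & ~ F A.
  apply: contrapT => H; apply: nFx => A xA; apply: contrapT => nFA.
  by apply: H; exists A.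
have [n _ nA] := ux _ xA.
have /finite_compact : finite_set [set u i | i in `I_n].
  exact/finite_image/finite_II.
rewrite compact_ultra => /(_ F FU)[|y [Cy Fy]].
  have [//|FA] := in_ultra_setVsetC A FU.
  apply: filterS (filterI FS FA) => _ [[[i _ <-]|->] nAu]; last first.
    by case: nAu; exact: nbhs_singleton.
  exists i => //=; rewrite ltnNge; apply/negP => ni; apply: nAu; exact: nA.
exists y; split => //; left; case: Cy => i _ <-; by exists i.
Qed.

(** * The weak topology *)

Lemma cvg_sup_initial (T : choiceType) (I : Type) (U : I -> topologicalType)
    (f : forall i, T -> U i) (F : set_system T) (x : T) : Filter F ->
  F --> (x : sup_topology (fun i => Topological.class (initial_topology (f i))))
  <-> forall i, f i @ F --> f i x.
Proof.
move=> FF; split=> [/cvg_sup Fx i A fA|Fx].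
  apply: (Fx i (f i @^-1` A)).
  exact: (@initial_continuous T (U i) (f i) x A fA).
apply/cvg_sup => i A /= [_ [[V oV <-] /= Vfx] VA].
by apply: filterS VA _; apply: Fx; apply: open_nbhs_nbhs.
Qed.

Section weak_sequences.
Variables (K : numFieldType) (X : normedModType K).

Lemma weak_cvgP (F : set_system X) (x : X) : Filter F ->
  F --> (x : weak X) <-> forall f : dual X, sval f @ F --> sval f x.
Proof. exact: (cvg_sup_initial (fun f : dual X => (sval f : X -> K^o))). Qed.

Lemma dual_weak_continuous (f : dual X) : continuous (sval f : weak X -> K^o).
Proof.
move=> x; have FF := nbhs_filter (x : weak X).
by have /weak_cvgP/(_ f) : nbhs (x : weak X) --> (x : weak X) by [].
Qed.

Lemma weak_regular : regular_space (weak X).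
Proof.
apply: (@sup_regular X (dual X)) => f; apply: initial_regular.
exact: uniform_regular.
Qed.

(** The closed unit ball of the dual space, as a set of bare functions: this is
the form in which it is a subset of a product of scalar fields. *)
Definition dual_ball : set {ptws X -> K^o} := [set f |
  (forall a x y, f (a *: x + y) = a * f x + f y) /\ forall x, `|f x| <= `|x|].

Lemma eval_continuous (x : X) :
  continuous ((fun f => f x) : {ptws X -> K^o} -> K^o).
Proof.
move=> f; have FF := nbhs_filter f.
have : nbhs f --> f by [].
by move/(cvg_sup_initial (fun i (f : forall x : X, K^o) => f i))/(_ x).
Qed.

Lemma dual_ball_continuous (f : X -> K^o) :
  dual_ball f -> continuous (f : weak X -> K^o).
Proof.
move=> [lf nf].
pose F : {linear X -> K^o} := HB.pack f (GRing.isLinear.Build _ _ _ _ f lf).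
have bF : bounded_operator F by exists 1 => x; rewrite mul1r; exact: nf.
exact (@dual_weak_continuous (exist _ F bF)).
Qed.

(** The two properties of the scalar field on which the extraction of weakly
convergent subsequences relies. *)
Hypothesis ballK : forall M : K, compact [set z : K^o | `|z| <= M].
Hypothesis arch : forall e : K, 0 < e -> exists n, n.+1%:R^-1 < e.

(** Banach-Alaoglu: the product of the scalar balls of radii |x| is compact by
Tychonoff's theorem, and linearity passes to pointwise limits. *)
Lemma dual_ball_compact : compact dual_ball.
Proof.
rewrite compact_ultra => F FU Fball.
have cP :
  compact ([set f | forall x : X, `|f x| <= `|x|] : set {ptws X -> K^o}).
  exact (@tychonoff X (fun=> K^o) (fun x => [set z | `|z| <= `|x|])
    (fun x => @ballK `|x|)).
move: cP; rewrite compact_ultra => /(_ F FU)[|g [ng Fg]].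
  by apply: filterS Fball => f [].
exists g; split => //; split => // a x y.
have gF : cluster F g by rewrite ultra_cvg_clusterE.
apply/subr0_eq.
pose h (f : {ptws X -> K^o}) : K^o := f (a *: x + y) - (a * f x + f y).
apply: (@cluster_cvg_eq _ K^o F g h 0) => //.
  have ev z : (fun f : {ptws X -> K^o} => f z : K^o) @ g --> (g z : K^o).
    exact: eval_continuous.
  have hlim := cvgB (ev (a *: x + y)) (cvgD (cvgMr (a := a) (ev x)) (ev y)).
  exact: hlim.
apply: cvg_near_cst; apply: filterS Fball => f [lf _].
by rewrite /h lf subrr.
Qed.

Lemma cvg_dist_inv (f : nat -> K^o) (l : K^o) :
  (\forall n \near \oo, `|l - f n| < n.+1%:R^-1) -> f @ \oo --> l.
Proof.
move=> fl; apply/cvgrPdist_lt => e /arch[n ne]; near=> m.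
have /lt_trans : `|l - f m| < m.+1%:R^-1 by near: m.
apply; apply: le_lt_trans ne.
by rewrite lef_pV2 ?posrE ?ltr0Sn// ler_nat ltnS; near: m; exists n.
Unshelve. all: by end_near. Qed.

(** A pointwise cluster point of a sequence of functionals is approximated on
b_0, ..., b_(N-1) by two of its terms, so infinitely many functionals cannot be
pairwise far apart there. *)
Lemma dual_ball_net (b : nat -> X) (N : nat) :
  exists2 s : seq {ptws X -> K^o}, {in s, forall d, dual_ball d} &
    forall f, dual_ball f -> exists2 d, d \in s &
      forall i, (i < N)%N -> `|f (b i) - d (b i)| < N.+1%:R^-1.
Proof.
set e := N.+1%:R^-1.
have e0 : 0 < e / 2 :> K by rewrite divr_gt0 ?invr_gt0 ?ltr0Sn.
apply: (@finite_net {ptws X -> K^o} dual_ball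
  (fun d f => forall i, (i < N)%N -> `|f (b i) - d (b i)| < e)) => u uB.
have [g [_ /cluster_seqE ug]] : dual_ball `&` cluster (u @ \oo) !=set0.
  by apply: dual_ball_compact; exact: range_eventually.
have gW m : nbhs g [set f : {ptws X -> K^o} |
    forall i, (i < m)%N -> `|g (b i) - f (b i)| < e / 2].
  elim: m => [|n IH]; first exact: filterE.
  have := @eval_continuous (b n) g.
  move=> /cvgrPdist_lt/(_ _ e0) gn.
  apply: filterS (filterI IH gn) => f [fi fn] i.
  by rewrite ltnS leq_eqVlt => /orP[/eqP ->|/fi].
have [i _ Wi] := ug _ (gW N) 0%N.
have [j ij Wj] := ug _ (gW N) i.+1.
exists i, j; split => // k kN.
rewrite (le_lt_trans (ler_distD (g (b k)) _ _))// (splitr e).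
by rewrite ltrD// ?Wi// distrC Wj.
Qed.

(** The easy half of the Eberlein-Smulian theorem.  It is enough that the index
map [sigma] tends to infinity, since the cluster points of [b \o sigma] are then
cluster points of [b]. *)
Lemma weakly_compact_subseq (B : set (weak X)) (b : nat -> X) :
  compact B -> (forall n, B (b n)) ->
  exists (sigma : nat -> nat) (x : X), (forall k, (k <= sigma k)%N) /\
    (b \o sigma) @ \oo --> (x : weak X).
Proof.
move=> cB bB.
have [x [Bx bx]] : B `&` cluster ((b : nat -> weak X) @ \oo) !=set0.
  by apply: cB; exact: range_eventually.
have /choice [D DB] : forall N, exists s : seq {ptws X -> K^o},
   {in s, forall d, dual_ball d} /\
    forall f, dual_ball f -> exists2 d, d \in s &
      forall i, (i < N)%N -> `|f (b i) - d (b i)| < N.+1%:R^-1.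
  by move=> N; have [s ? ?] := dual_ball_net b N; exists s.
(* [D N] is the N-th net.  The k-th term of the subsequence is close to x for
   the functionals of the nets D 0, ..., D k. *)
have /choice [sigma sigmaP] : forall k, exists n, (k <= n)%N /\
    {in flatten [seq D j | j <- iota 0 k.+1], forall d : {ptws X -> K^o},
       `|d x - d (b n)| < k.+1%:R^-1}.
  move=> k; set s := flatten _.
  have sB : {in s, forall d, dual_ball d}.
    by move=> d /flattenP[_ /mapP[j _ ->]]; exact: (DB j).1.
  have xW : nbhs (x : weak X) [set y | {in s, forall d : {ptws X -> K^o},
       `|d x - d y| < k.+1%:R^-1}].
    elim: s sB => [|d s IH] sB; first exact: filterE.
    have := @dual_ball_continuous d (sB d (mem_head _ _)) x.
    move=> /cvgrPdist_lt/(_ k.+1%:R^-1) -/(_ _)/filterI H.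
    have IHs : {in s, forall d, dual_ball d}.
      by move=> c cs; apply: sB; rewrite inE cs orbT.
    apply: filterS (H _ _ (IH IHs)); last by rewrite invr_gt0 ltr0Sn.
    move=> y [dy sy] c.
    by rewrite inE => /orP[/eqP ->|/sy].
  have [n kn xn] := (cluster_seqE _ _).1 bx _ xW k.
  by exists n.
have sub : (b \o sigma : nat -> weak X) @ \oo --> ((b : nat -> weak X) @ \oo).
  move=> A [n _ nA]; exists n => // k /= nk; apply: nA => /=.
  by apply: leq_trans nk _; exact: (sigmaP k).1.
(* All weak cluster points of the subsequence have the same image as x under
   the functionals of the dual ball. *)
have same y f : cluster ((b \o sigma : nat -> weak X) @ \oo) y ->
    dual_ball f -> f y = f x.
  move=> sy fB; have yb := cvg_cluster sub sy.
  have /choice [d dP] : forall N, exists d, d \in D N /\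
      forall i, (i < N)%N -> `|f (b i) - d (b i)| < N.+1%:R^-1.
    by move=> N; have [d ? ?] := (DB N).2 f fB; exists d.
  have dB N : dual_ball (d N) by apply: (DB N).1; exact: (dP N).1.
  have [g [gB gd]] : dual_ball `&` cluster (d @ \oo) !=set0.
    by apply: dual_ball_compact; exact: range_eventually.
  (* g agrees with f on the sequence, hence at x and y; but it is also a
     pointwise cluster point of functionals that take the same value at x and
     y. *)
  have gb i : g (b i) = f (b i).
    apply: (@cluster_cvg_eq {ptws X -> K^o} K^o (d @ \oo) g
      (fun h => h (b i)) (f (b i))) => //; first exact: eval_continuous.
    apply: cvg_dist_inv; exists i.+1 => // N iN.
    by apply: (dP N).2.
  have gf z : cluster ((b : nat -> weak X) @ \oo) z -> g z = f z.
    move=> bz; apply/subr0_eq.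
    apply: (@cluster_cvg_eq (weak X) K^o (b @ \oo) z
      (fun z => g z - f z) 0) => //.
      have cg := @dual_ball_continuous g gB z.
      by have := cvgB cg (@dual_ball_continuous f fB z); exact.
    by apply: cvg_near_cst; apply: range_eventually => n /=; rewrite gb subrr.
  rewrite -!gf//; apply/subr0_eq.
  apply: (@cluster_cvg_eq {ptws X -> K^o} K^o (d @ \oo) g
    (fun h => h y - h x) 0) => //.
    have cy := @eval_continuous y g.
    by have := cvgB cy (@eval_continuous x g); exact.
  apply: cvg_near_cst; apply: range_eventually => N /=.
  apply/eqP; rewrite subr_eq0; apply/eqP.
  apply: (@cluster_cvg_eq (weak X) K^o ((b \o sigma) @ \oo) y (d N)) => //.
    exact: dual_ball_continuous.
  apply: cvg_dist_inv; exists N => // k Nk; apply: (sigmaP k).2.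
  apply/flattenP; exists (D N); last exact: (dP N).1.
  by apply/mapP; exists N => //; rewrite mem_iota.
exists sigma, x; split=> [k|]; first exact: (sigmaP k).1.
apply/weak_cvgP => f.
apply: (@compact_unique_cluster_cvg (weak X) K^o B _ (sval f)) => //.
- by apply: range_eventually => n; exact: bB.
- exact: dual_weak_continuous.
move=> z Bz sz; case: f => f [M fM] /=.
(* Any bounded functional is a multiple of an element of the dual ball; the
   absolute value and the 1 make the factor positive whatever M is. *)
pose c := `|M| + 1.
have c0 : 0 < c by rewrite ltr_wpDl.
have fc : dual_ball (fun x => c^-1 * f x).
  split=> [a u v|u]; first by rewrite linearP mulrDr mulrCA.
  rewrite normrM normfV (gtr0_norm c0) mulrC ler_pdivrMr// mulrC.
  apply: (@le_trans _ _ (`|M| * `|u|)); last by rewrite ler_wpM2r// lerDl.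
  rewrite -[in leRHS](normr_id u) -normrM (@ger0_norm _ (M * `|u|))//.
  exact: le_trans (fM u).
by have /mulfI := same z _ sz fc; apply; rewrite invr_eq0 gt_eqF.
Qed.

End weak_sequences.

(** * Operators into l_p *)

Section lp_operators.
Variables (R : realType) (K : numFieldType) (s : scalars R K).
Variables (p : R) (p1 : 1 <= p).

(** One term of the series of p-th powers is at most its sum. *)
Lemma lp_coord_le (f : lp s p1) (k : nat) : `|lp_val f k| <= `|f|.
Proof.
have a0 z : 0 <= absr s z by rewrite -(emb_mono s) rmorph0 -absrE.
have p0 : 0 < p by exact: lt_le_trans ltr01 p1.
rewrite (absrE s) [leRHS]/(emb s _) (emb_mono s) -lee_fin.
have fE : (lp_enorm s p (lp_val f) \is a fin_num)%E.
  by rewrite ge0_fin_numE ?Lnorm_ge0//; exact: lp_valP.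
rewrite fineK// /lp_enorm Lnorm_counting//=.
have -> : (absr s (lp_val f k))%:E =
    poweR ((absr s (lp_val f k)) `^ p)%:E p^-1.
  by rewrite poweR_EFin -powRrM mulfV ?gt_eqF// powRr1.
have t0 n : (0 <= (`|absr s (lp_val f n)| `^ p)%:E)%E.
  by rewrite lee_fin powR_ge0.
apply: gt0_ler_poweR.
- by rewrite invr_ge0 ltW.
- by rewrite in_itv/= lee_fin powR_ge0 leey.
- by rewrite in_itv/= leey andbT; apply: nneseries_ge0 => n _ _; exact: t0.
apply: le_trans (nneseries_lim_ge k.+1 _); last by move=> n _ _; exact: t0.
by rewrite big_nat_recr//= ger0_norm// leeDr// sume_ge0.
Qed.

Lemma lp_coord_continuous (k : nat) :
  continuous ((fun f => lp_val f k) : lp s p1 -> K^o).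
Proof.
move=> f; have FF := nbhs_filter f.
apply/cvgrPdist_lt => e e0; apply: filterS (nbhsx_ballx f e e0) => g.
by rewrite -ball_normE; apply: le_lt_trans; exact: (lp_coord_le (f - g)).
Qed.

Variables (X : normedModType K) (T : {linear X -> lp s p1}).
Hypothesis bT : bounded_operator T.

Lemma lp_coord_dual (k : nat) : exists f : dual X,
  forall x, sval f x = lp_val (T x) k.
Proof.
pose g x : K^o := lp_val (T x) k.
have lg a x y : g (a *: x + y) = a *: g x + g y by rewrite /g linearP.
pose G : {linear X -> K^o} := HB.pack g (GRing.isLinear.Build _ _ _ _ g lg).
have bG : bounded_operator G.
  have [M TM] := bT; exists M => x.
  by apply: le_trans (TM x); exact: lp_coord_le.
by exists (exist _ G bG).
Qed.

(** Coordinatewise, T u_n converges to T x because the coordinates of T are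
bounded functionals; norm cluster points are coordinatewise cluster points. *)
Lemma weak_cvg_image_cluster (u : nat -> X) (x : X) (l : lp s p1) :
  u @ \oo --> (x : weak X) -> cluster (T \o u @ \oo) l -> l = T x.
Proof.
move=> /weak_cvgP ux ul; apply/val_inj/funext => k /=.
apply: (cluster_cvg_eq _ _ _ ul (g := fun f => lp_val f k : K^o)) => //.
  exact: lp_coord_continuous.
have [f fE] := lp_coord_dual k.
rewrite -fE => A /(ux f)[N _ NA]; exists N => // n Nn.
by have := NA n Nn; rewrite /= fE.
Qed.

End lp_operators.

(** * The equivalence over a general scalar field *)

Theorem coarse_p_DPstar_completely_continuous (R : realType)
    (K : numFieldType) (s : scalars R K) (p : R) (p1 : 1 <= p)
    (X : normedModType K) :
  (forall M : K, compact [set z : K^o | `|z| <= M]) ->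
  (forall e : K, 0 < e -> exists n, n.+1%:R^-1 < e) ->
  coarse_p_DPstar s p1 X <->
  forall T : {linear X -> lp s p1},
    bounded_operator T -> completely_continuous T.
Proof.
move=> ballK arch; split=> [DP T bT u /cvg_ex[x ux]|CC A cA T bT].
  have [U TU [cU _]] : precompact (T @` range u).
    apply: DP => //; apply: (regular_precompact (@weak_regular K X)
      (cvg_range_compact ux)).
    by move=> _ [n _ <-]; left; exists n.
  apply: (cvgP (T x)).
  apply: (@compact_unique_cluster_cvg _ _ U (T \o u @ \oo) id (T x)) => //.
  - by apply: range_eventually => n; apply: TU; exists (u n) => //; exists n.
  - by move=> l A.
  - by move=> l _ ul; exact: (weak_cvg_image_cluster bT ux).
have cB : compact (closure (A : set (weak X))) by rewrite -precompactE.
set B := closure _ in cB.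
suff cTB : compact (T @` B).
  apply: precompact_subset (compact_precompact (@norm_hausdorff _ _) cTB).
  by apply: image_subset; exact: (@subset_closure (weak X)).
apply: seq_cluster_compact => // v vTB.
have /choice [b bP] : forall n, exists x, B x /\ T x = v n.
  by move=> n; have [x ? ?] := vTB n; exists x.
have [sigma [x [sigma_ge bx]]] :=
  weakly_compact_subseq (@ballK) arch cB (fun n => (bP n).1).
have /(CC T bT)/cvg_ex[l Tl] : weakly_convergent (b \o sigma).
  by apply/cvg_ex; exists x.
have lTx : l = T x.
  apply: (weak_cvg_image_cluster bT bx).
  apply/cluster_seqE => W /Tl[N _ NW] n.
  by exists (maxn N n); [exact: leq_maxr|apply: NW => /=; exact: leq_maxl].
exists l.
  exists x => //; apply: (@closed_closure (weak X)) => W /bx[N _ NW].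
  by exists (b (sigma N)); split; [exact: (bP _).1|exact: (NW N (leqnn N))].
apply/cluster_seqE => W lW n.
have [m _ mW] := Tl _ lW.
exists (sigma (maxn m n)); first by rewrite (leq_trans (leq_maxr m n)).
by rewrite -(bP _).2; apply: mW => /=; exact: leq_maxl.
Qed.

(** * The real and complex scalar fields *)

(** A positive scalar is the image of a positive real number. *)
Lemma scalars_archimedean (R : realType) (K : numFieldType) (s : scalars R K)
    (e : K) : 0 < e -> exists n, n.+1%:R^-1 < e.
Proof.
move=> e0; have := absrE s e; rewrite gtr0_norm// => eE.
have a0 : 0 < absr s e by rewrite -(leW_mono (emb_mono s)) rmorph0 -eE.
exists (Num.truncn (absr s e)^-1); rewrite [ltRHS]eE.
rewrite -(rmorph_nat (emb s)) -fmorphV (leW_mono (emb_mono s)).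
rewrite invf_plt ?posrE ?ltr0Sn//.
exact: truncnS_gt.
Qed.

Lemma real_ball_compact (R : realType) (M : R) :
  compact [set z : R^o | `|z| <= M].
Proof.
rewrite (_ : [set _ | _] = `[- M, M]%classic); first exact: segment_compact.
by apply/seteqP; split => z /=; rewrite in_itv/= ler_norml.
Qed.

Lemma norm_ball_closed (K : numFieldType) (V : normedModType K) (M : K) :
  0 <= M -> closed [set z : V | `|z| <= M].
Proof.
move=> M0 z clz /=; rewrite real_leNgt ?ger0_real//; apply/negP => Mz.
have e0 : 0 < `|z| - M by rewrite subr_gt0.
have [w [/= wM]] := clz _ (nbhsx_ballx z _ e0).
rewrite -ball_normE /= => zw.
suff : `|z| < `|z| by rewrite ltxx.
rewrite -[X in `|X| < _](subrK w z) (le_lt_trans (ler_normD _ _))//.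
by rewrite -[ltRHS](subrK M) ltr_leD.
Qed.

(** The ball is a closed subset of the image of the square [-r, r]^2 under the
continuous map (a, b) |-> a + ib, where r is the radius. *)
Lemma complex_ball_compact (R : realType) (M : R[i]) :
  compact [set z : R[i]^o | `|z| <= M].
Proof.
have [M0|nM0] := boolP (0 <= M); last first.
  rewrite (_ : [set _ | _] = set0); first exact: compact0.
  apply/seteqP; split => // z /= zM; case/negP: nM0.
  exact: le_trans zM.
pose r := complex.Re M.
have Mr : M = r%:C%C.
  by case: M M0 @r => a b /=; rewrite lecE /= => /andP[/eqP -> _].
have nC (t : R) : `|t%:C%C : R[i]| = `|t|%:C%C.
  by rewrite normc_def /= expr0n addr0 sqrtr_sqr.
have ni : `|'i%C : R[i]| = 1.
  by rewrite normc_def /= expr0n expr1n add0r sqrtr1.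
pose g (x : R * R) : R[i]^o := (x.1 +i* x.2)%C.
have gc : continuous g.
  move=> x; apply/cvgrPdist_lt => e e0.
  have eE : e = (complex.Re e)%:C%C.
    by case: e e0 => a b /=; rewrite ltcE /= => /andP[/eqP -> _].
  have e2 : 0 < complex.Re e / 2.
    by move: e0; rewrite eE ltcE /= => /andP[_ ?]; rewrite divr_gt0.
  have h1 : \forall y \near x, `|x.1 - y.1| < complex.Re e / 2.
    have : (fst : R * R -> R) @ x --> x.1 by exact: cvg_fst.
    by move=> /cvgrPdist_lt/(_ _ e2).
  have h2 : \forall y \near x, `|x.2 - y.2| < complex.Re e / 2.
    have : (snd : R * R -> R) @ x --> x.2 by exact: cvg_snd.
    by move=> /cvgrPdist_lt/(_ _ e2).
  apply: filterS2 h1 h2 => y y1 y2.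
  rewrite [ltRHS]eE (splitr (complex.Re e)) rmorphD.
  have -> : g x - g y = (x.1 - y.1)%:C%C + 'i%C * (x.2 - y.2)%:C%C.
    by rewrite /g; simpc.
  rewrite (le_lt_trans (ler_normD _ _))// normrM ni mul1r !nC.
  by rewrite ltrD// ltcR.
have cg : compact (g @` (`[- r, r] `*` `[- r, r])).
  apply: continuous_compact; first exact: continuous_subspaceT.
  by apply: compact_setX; exact: segment_compact.
apply: subclosed_compact cg _; first exact: norm_ball_closed.
move=> z /= zM; exists (complex.Re z, complex.Im z); last by case: z {zM}.
have le_r (t : R) : `|t|%:C%C <= `|z| -> `|t| <= r.
  by move=> /le_trans/(_ zM); rewrite Mr lecR.
rewrite /= !in_itv/= -!ler_norml; split; apply: le_r; first exact: normc_ge_Re.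
by have := normc_ge_Re (z * 'i%C); rewrite ReiNIm normrN normrM ni mulr1.
Qed.

Theorem theorem3p3 (R : realType) (p : R) (p1 : 1 <= p) :
  (forall X : completeNormedModType R,
     coarse_p_DPstar (real_scalars R) p1 X <->
     forall T : {linear X -> lp (real_scalars R) p1},
       bounded_operator T -> completely_continuous T) /\
  (forall X : completeNormedModType R[i],
     coarse_p_DPstar (complex_scalars R) p1 X <->
     forall T : {linear X -> lp (complex_scalars R) p1},
       bounded_operator T -> completely_continuous T).
Proof.
split=> X; apply: coarse_p_DPstar_completely_continuous.
- exact: real_ball_compact.
- exact: (scalars_archimedean (real_scalars R)).
- exact: complex_ball_compact.
- exact: (scalars_archimedean (complex_scalars R)).
Qed.
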